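(* Let $G$ be a claw-o-heavy and $Z_1$-c-heavy graph. Then $\mathrm{cl}^{\mathrm c}(G)$ is also $Z_1$-c-heavy.
   Context: All graphs are finite and simple. For a graph $G$ on $n=|V(G)|$ vertices, a vertex $v$ is heavy if $d_G(v)\geq n/2$; a pair $\{u,v\}$ is a heavy pair of $G$ if $uv\notin E(G)$ and $d_G(u)+d_G(v)\geq n$. $G$ is claw-o-heavy if every induced $K_{1,3}$ of $G$ contains a heavy pair of $G$. For a graph $S$, $G$ is $S$-c-heavy if for every induced subgraph $G'$ of $G$ isomorphic to $S$ and every maximal clique $C$ of $G'$, every component of $G'-C$ with at least two vertices contains a vertex heavy in $G$. $Z_1$ is the graph obtained from a triangle by attaching one pendant edge to one vertex. For $x\in V(G)$, $G'_x$ is obtained from $G$ by adding all missing edges $uv$ with $u,v\in N_G(x)$. For claw-o-heavy $G$ and $x\in V(G)$, let $G^*$ be obtained from $G$ by adding all missing edges $uv$ with $u,v\in N_G(x)$ and $\{u,v\}$ a heavy pair of $G$; $x$ is c-eligible if $N_G(x)$ is not a clique and either $G^*[N_G(x)]$ is connected, or $G^*[N_G(x)]$ consists of two disjoint cliques $C_1,C_2$ and some $z$ with $\{x,z\}$ a heavy pair of $G$ has $zy_1,zy_2\in E(G)$ for some $y_1\in C_1,y_2\in C_2$. The c-closure $\mathrm{cl}^{\mathrm c}(G)$ of a claw-o-heavy graph $G$ is obtained by a sequence $G=G_1,\dots,G_t=\mathrm{cl}^{\mathrm c}(G)$ with $G_{j+1}=(G_j)'_{x_j}$ for a c-eligible vertex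 $x_j$ of $G_j$, where $G_t$ has no c-eligible vertex; it is well defined (Čada). Heaviness in $\mathrm{cl}^{\mathrm c}(G)$ uses degrees in $\mathrm{cl}^{\mathrm c}(G)$ and the same $n$. *)

(* Defs.v *)
From Stdlib Require Classical_Prop.
From mathcomp Require Import all_boot.

Set Implicit Arguments.
Unset Strict Implicit.
Unset Printing Implicit Defensive.

Record sgraph (T : finType) := SGraph {
  adj :> rel T;
  adj_sym : symmetric adj;
  adj_irr : irreflexive adj }.

Section Graphs.
Variable T : finType.
Implicit Types (G H : sgraph T) (A B C D : {set T}) (u v x y z : T).

Definition nbhd G x : {set T} := [set y | G x y].
Definition deg G x : nat := #|nbhd G x|.

Definition heavy G x : bool := #|T| <= 2 * deg G x.

Definition heavy_pair G u v : bool :=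
  [&& u != v, ~~ G u v & #|T| <= deg G u + deg G v].

Definition clique G C : bool :=
  [forall u in C, forall v in C, (u != v) ==> G u v].

(* Adjacency of the subgraph induced by A. *)
Definition induced G A : rel T := [rel u v | [&& u \in A, v \in A & G u v]].

Definition component G A D : Prop :=
  exists2 x, x \in A & D = [set y in A | connect (induced G A) x y].

Definition connected_on G A : Prop :=
  A != set0 /\ {in A &, forall u v, connect (induced G A) u v}.

Definition maximal_clique G A C : bool :=
  maxset [pred K : {set T} | (K \subset A) && clique G K] C.

(* The subgraph of G induced by A is isomorphic to S. *)
Definition induced_copy (V : finType) (S : sgraph V) G A : Prop :=
  exists f : V -> T,
    [/\ injective f, (forall i j, G (f i) (f j) = S i j) & A = [set f i | i : V]].

Definition c_heavy (V : finType) (S : sgraph V) G : Prop :=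
  forall A, induced_copy S G A ->
  forall C, maximal_clique G A C ->
  forall D, component G (A :\: C) D -> 2 <= #|D| ->
  exists2 v, v \in D & heavy G v.

Definition completion_rel G x : rel T :=
  [rel u v | G u v || [&& u != v, u \in nbhd G x & v \in nbhd G x]].

Lemma completion_sym G x : symmetric (completion_rel G x).
Proof. by move=> u v; rewrite /completion_rel /= (adj_sym G) eq_sym [(u \in _) && _]andbC. Qed.

Lemma completion_irr G x : irreflexive (completion_rel G x).
Proof. by move=> u; rewrite /completion_rel /= (adj_irr G) eqxx. Qed.

(* G'_x *)
Definition local_completion G x : sgraph T :=
  SGraph (completion_sym G x) (completion_irr G x).

Definition star_rel G x : rel T :=
  [rel u v | G u v ||
    [&& u \in nbhd G x, v \in nbhd G x & heavy_pair G u v]].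

Lemma star_sym G x : symmetric (star_rel G x).
Proof.
move=> u v; rewrite /star_rel /heavy_pair /= (adj_sym G) eq_sym addnC.
by rewrite !andbA [(u \in _) && _]andbC.
Qed.

Lemma star_irr G x : irreflexive (star_rel G x).
Proof. by move=> u; rewrite /star_rel /heavy_pair /= (adj_irr G) eqxx !andbF. Qed.

(* G^* (relative to x) *)
Definition star G x : sgraph T := SGraph (star_sym G x) (star_irr G x).

(* The subgraph induced by A is the disjoint union of the cliques C1 and C2. *)
Definition two_disjoint_cliques G A C1 C2 : Prop :=
  [/\ C1 :|: C2 = A, [disjoint C1 & C2], clique G C1, clique G C2 &
      {in C1 & C2, forall u v, ~~ G u v}].

Definition c_eligible G x : Prop :=
  ~~ clique G (nbhd G x) /\
  (connected_on (star G x) (nbhd G x) \/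
   exists C1 C2, two_disjoint_cliques (star G x) (nbhd G x) C1 C2 /\
     exists z y1 y2,
       [/\ heavy_pair G x z, y1 \in C1, y2 \in C2, G z y1 & G z y2]).

(* [c_closure G H]: some sequence of local completions at c-eligible vertices
   leads from G to H, and H has no c-eligible vertex.  H does not depend on the
   choices when G is claw-o-heavy (Cada); as a relation, [c_closure] covers all
   of them. *)
Inductive c_closure : sgraph T -> sgraph T -> Prop :=
| CClosureStop G of (forall x, ~ c_eligible G x) : c_closure G G
| CClosureStep G x H of c_eligible G x & c_closure (local_completion G x) H :
    c_closure G H.

End Graphs.

(* K_{1,3} with centre 0. *)
Definition claw_rel : rel 'I_4 := [rel i j | (i == ord0) (+) (j == ord0)].

Lemma claw_sym : symmetric claw_rel.
Proof. by move=> i j; rewrite /claw_rel /= addbC. Qed.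

Lemma claw_irr : irreflexive claw_rel.
Proof. by move=> i; rewrite /claw_rel /= addbb. Qed.

Definition claw : sgraph 'I_4 := SGraph claw_sym claw_irr.

(* Triangle 0, 1, 2 with the pendant edge {2, 3}. *)
Definition Z1_rel : rel 'I_4 :=
  [rel i j : 'I_4 | (minn i j, maxn i j) \in [:: (0, 1); (0, 2); (1, 2); (2, 3)]].

Lemma Z1_sym : symmetric Z1_rel.
Proof. by move=> i j; rewrite /Z1_rel /= minnC maxnC. Qed.

Lemma Z1_irr : irreflexive Z1_rel.
Proof. by move=> i; rewrite /Z1_rel /= minnn maxnn; case: i => [[|[|[|[|]]]]]. Qed.

Definition Z1 : sgraph 'I_4 := SGraph Z1_sym Z1_irr.

Definition claw_o_heavy (T : finType) (G : sgraph T) : Prop :=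
  forall A, induced_copy claw G A ->
  exists u v, [/\ u \in A, v \in A & heavy_pair G u v].

(* Each completion at a c-eligible vertex adds an edge, so the iteration stops. *)
Lemma c_closure_exists (T : finType) (G : sgraph T) : exists H, c_closure G H.
Proof.
pose non_edges (K : sgraph T) := [set p : T * T | ~~ K p.1 p.2].
have [n] := ubnP #|non_edges G|; elim: n G => // n IHn G lt_n.
have [[x elx]|noel] := Classical_Prop.classic (exists x, c_eligible G x); last first.
  by exists G; apply: CClosureStop => x elx; apply: noel; exists x.
have [|H clH] := IHn (local_completion G x); last first.
  by exists H; apply: CClosureStep elx clH.
rewrite ltnS in lt_n; apply: leq_trans lt_n; apply: proper_card; apply/properP; split.
  by apply/subsetP=> p; rewrite !inE /= negb_or => /andP[].
case: (elx) => /forall_inPn[u Nu /forall_inPn[v Nv]].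
rewrite negb_imply => /andP[neq_uv nGuv] _.
rewrite !inE in Nu Nv.
by exists (u, v); rewrite !inE /= ?nGuv // /completion_rel /= !inE neq_uv Nu Nv orbT.
Qed.

(* Main.v *)
(** Let H be the c-closure of G. Claw-o-heaviness survives each completion, and
    a closed claw-o-heavy graph has no heavy pair and no induced diamond.
    Consider an intermediate graph G' and the property that, whenever c has
    G'-neighbours a, b, d with a and b not H-adjacent to d, one of a, b is heavy
    in H. Completing G' at x makes x simplicial in H, so K = N_H[x] is a maximal
    clique. If x is light, every vertex of K with a neighbour outside K has at
    most one light G'-neighbour in K; since those outside neighbours are distinct
    for distinct vertices, counting shows that no two vertices of K form a heavy
    pair of G'. Hence x is eligible because N_G'(x) is connected in G' itself,
    and connectedness spreads simpliciality from one light vertex of N_G'(x) to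
    all the others; so the property is preserved. At G' = H it says that H is
    Z_1-c-heavy. *)

Require Import Defs.
From mathcomp Require Import all_boot zify.

Set Implicit Arguments.
Unset Strict Implicit.
Unset Printing Implicit Defensive.

Section Graphs.
Variable T : finType.
Implicit Types (G H : sgraph T) (A B C D : {set T}).
Implicit Types (a b c d p q r s t u v w x y z : T).

(** * Degrees, heaviness and local completion *)

Lemma adj_neq G u v : G u v -> u != v.
Proof. by apply: contraTneq => ->; rewrite adj_irr. Qed.

Lemma heavy_pairC G u v : heavy_pair G u v = heavy_pair G v u.
Proof. by rewrite /heavy_pair eq_sym adj_sym addnC. Qed.

Lemma light_heavy_pair G u v :
  ~~ heavy G u -> ~~ heavy G v -> ~~ heavy_pair G u v.
Proof. by rewrite /heavy => ? ?; apply/negP => /and3P[_ _]; lia. Qed.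

Lemma deg_mono G H u : subrel G H -> deg G u <= deg H u.
Proof.
by move=> sGH; apply/subset_leq_card/subsetP => v; rewrite !inE; apply: sGH.
Qed.

Lemma heavy_mono G H u : subrel G H -> heavy G u -> heavy H u.
Proof. by move=> /(deg_mono u); rewrite /heavy; lia. Qed.

Lemma heavy_pair_mono G H u v :
  subrel G H -> ~~ H u v -> heavy_pair G u v -> heavy_pair H u v.
Proof.
move=> sGH nHuv /and3P[neq_uv _ le_n]; apply/and3P; split=> //.
by apply: (leq_trans le_n); apply: leq_add; apply: deg_mono.
Qed.

(** The hypotheses amount to an inclusion of closed neighbourhoods. Closed ones allow [u] and [v] to
    be adjacent, when open neighbourhoods in one graph are never nested. *)
Lemma deg_le_of_cnbhd G H u v :
  (forall w, G u w -> (w == v) || H v w) -> (u == v) || H v u ->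
  deg G u <= deg H v.
Proof.
move=> sN uv; rewrite -ltnS /deg.
have -> : #|nbhd G u|.+1 = #|u |: nbhd G u| by rewrite cardsU1 !inE adj_irr.
have -> : #|nbhd H v|.+1 = #|v |: nbhd H v| by rewrite cardsU1 !inE adj_irr.
by apply/subset_leq_card/subsetP => w; rewrite !inE => /orP[/eqP->|/sN].
Qed.

Lemma completionE G x u v :
  local_completion G x u v = G u v || [&& u != v, G x u & G x v].
Proof. by rewrite /= /completion_rel /= !inE. Qed.

Lemma starE G x u v :
  star G x u v = G u v || [&& G x u, G x v & heavy_pair G u v].
Proof. by rewrite /= /star_rel /= !inE. Qed.

Lemma completion_subrel G x : subrel G (local_completion G x).
Proof. by move=> u v Guv; rewrite completionE Guv. Qed.

Lemma completion_adj G x u v :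
  G x u -> G x v -> u != v -> local_completion G x u v.
Proof. by move=> xu xv neq_uv; rewrite completionE neq_uv xu xv orbT. Qed.

Lemma completion_adj_closed G x u v :
  (u == x) || G x u -> G x v -> u != v -> local_completion G x u v.
Proof.
case/orP => [/eqP-> xv _|]; [exact: completion_subrel | exact: completion_adj].
Qed.

Lemma completion_new G x u v :
  local_completion G x u v -> ~~ G u v -> G x u /\ G x v.
Proof. by rewrite completionE => /orP[->//|/and3P[_]]. Qed.

Lemma c_closure_subrel G H : c_closure G H -> subrel G H.
Proof.
by elim=> [{}G _ u v //|{}G x {}H _ _ IH u v Guv]; apply/IH/completion_subrel.
Qed.

(** * Claws and their survival under completion *)

Lemma claw_o_heavyP G :
  claw_o_heavy G <->
  forall c p q r, G c p -> G c q -> G c r -> p != q -> p != r -> q != r ->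
    ~~ G p q -> ~~ G p r -> ~~ G q r ->
    [|| heavy_pair G p q, heavy_pair G p r | heavy_pair G q r].
Proof.
split=> [clawG c p q r cp cq cr pq pr qr npq npr nqr | clawG A [f [injf fG ->]]].
  pose l := [:: c; p; q; r]; pose f (i : 'I_4) := nth c l i.
  have ul : uniq l.
    by rewrite /= !inE !negb_or !(adj_neq cp, adj_neq cq, adj_neq cr, pq, pr, qr).
  have [|u [v [/imsetP[i _ ->] /imsetP[j _ ->]]]] := clawG [set f i | i : 'I_4].
    exists f; split=> // [i j /eqP|i j].
      by rewrite nth_uniq ?ltn_ord // => /eqP/val_inj.
    case: i => [[|[|[|[|//]]]] ?]; case: j => [[|[|[|[|//]]]] ?];
      rewrite /f /= /claw_rel /= ?adj_irr //;
      by rewrite ?(negPf npq) ?(negPf npr) ?(negPf nqr)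
        1?adj_sym ?cp ?cq ?cr ?(negPf npq) ?(negPf npr) ?(negPf nqr).
  (* Equal indices and pairs containing the centre cannot be heavy; two leaves may come in either
     order, hence the symmetric copy [h']. *)
  case: i => [[|[|[|[|//]]]] ?]; case: j => [[|[|[|[|//]]]] ?];
    rewrite /f /= => h; move: (h);
    by rewrite 1?[in X in X -> _]heavy_pairC => h'; rewrite ?h ?h' ?orbT //;
       move: h; rewrite /heavy_pair ?eqxx // ?cp ?cq ?cr ?andbF //
         1?adj_sym ?cp ?cq ?cr ?andbF.
have fE i j : (f i == f j) = (i == j) by rewrite (inj_eq injf).
have := clawG (f (@Ordinal 4 0 isT)) (f (@Ordinal 4 1 isT))
  (f (@Ordinal 4 2 isT)) (f (@Ordinal 4 3 isT)).
rewrite !fG !fE => /(_ isT isT isT isT isT isT isT isT isT).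
by case/or3P=> h; do 2!eexists; (split; last exact: h); apply: imset_f.
Qed.

(** If the edge [c p] of a claw is new, the other leaves avoid N_G[x], so their edges are old and
    replacing [p] by [x] gives a claw of [G]. A heavy pair {x, t} there yields {p, t}, because
    completion puts N_G[x] inside the closed neighbourhood of [p]. *)
Lemma completion_claw_o_heavy G x :
  claw_o_heavy G -> claw_o_heavy (local_completion G x).
Proof.
move=> /claw_o_heavyP clawG; apply/claw_o_heavyP; set G1 := local_completion G x.
have sG : subrel G G1 := @completion_subrel G x.
have nG u v : ~~ G1 u v -> ~~ G u v by apply/contra/sG.
have new c p q r : G1 c p -> ~~ G c p -> G1 c q -> G1 c r ->
    p != q -> p != r -> q != r -> ~~ G1 p q -> ~~ G1 p r -> ~~ G1 q r ->
    [|| heavy_pair G1 p q, heavy_pair G1 p r | heavy_pair G1 q r].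
  move=> cp ncp cq cr pq pr qr npq npr nqr.
  have [xc xp] := completion_new cp ncp.
  have far t : p != t -> ~~ G1 p t -> ~~ ((t == x) || G x t).
    move=> pt; apply: contra => h.
    by rewrite adj_sym completion_adj_closed // eq_sym.
  have old t : G1 c t -> p != t -> ~~ G1 p t -> G c t.
    move=> ct pt npt; apply: contraT => /(completion_new ct)[_ xt].
    by have := far _ pt npt; rewrite xt orbT.
  have dx : deg G x <= deg G1 p.
    apply: deg_le_of_cnbhd => [w xw|]; last by rewrite adj_sym sG ?orbT.
    by case: eqVneq => // wp; apply: completion_adj; rewrite // eq_sym.
  have hp t : p != t -> ~~ G1 p t -> heavy_pair G x t -> heavy_pair G1 p t.
    move=> pt npt /and3P[_ _ le_n]; apply/and3P; split=> //.
    by apply: (leq_trans le_n); apply: leq_add => //; apply: deg_mono.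
  have := far _ pq npq; have := far _ pr npr; rewrite !negb_or.
  rewrite ![_ == x]eq_sym => /andP[xr nxr] /andP[xq nxq].
  have cx : G c x by rewrite adj_sym.
  have := clawG _ _ _ _ cx (old _ cq pq npq) (old _ cr pr npr) xq xr qr nxq nxr
    (nG _ _ nqr).
  case/or3P => [/(hp _ pq npq)->//|/(hp _ pr npr)->|/(heavy_pair_mono sG nqr)->];
  by rewrite !orbT.
move=> c p q r cp cq cr pq pr qr npq npr nqr.
have [Gcp|ncp] := boolP (G c p); last exact: (new c).
have [Gcq|ncq] := boolP (G c q); last first.
  have := new _ _ _ _ cq ncq cp cr; rewrite 2!(eq_sym q) 2!(adj_sym _ q).
  rewrite (heavy_pairC _ q) [r == q]eq_sym (adj_sym _ r).
  by move=> /(_ pq qr pr npq nqr npr) /or3P[]->; rewrite ?orbT.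
have [Gcr|ncr] := boolP (G c r); last first.
  have := new _ _ _ _ cr ncr cp cq; rewrite 2!(eq_sym r) 2!(adj_sym _ r).
  rewrite 2!(heavy_pairC _ r).
  by move=> /(_ pr qr pq npr nqr npq) /or3P[]->; rewrite ?orbT.
have := clawG _ _ _ _ Gcp Gcq Gcr pq pr qr (nG _ _ npq) (nG _ _ npr) (nG _ _ nqr).
by case/or3P => /(heavy_pair_mono sG) ->; rewrite ?orbT.
Qed.

Lemma c_closure_claw_o_heavy G H :
  c_closure G H -> claw_o_heavy G -> claw_o_heavy H.
Proof.
by elim=> [//|{}G x {}H _ _ IH clawG]; apply/IH/completion_claw_o_heavy.
Qed.

Lemma c_closure_closed G H : c_closure G H -> forall x, ~ c_eligible H x.
Proof. by elim. Qed.

Lemma not_clique G A u v :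
  u \in A -> v \in A -> u != v -> ~~ G u v -> ~~ clique G A.
Proof.
move=> uA vA uv nuv; apply/negP => /forall_inP/(_ u uA)/forall_inP/(_ v vA).
by rewrite uv (negPf nuv).
Qed.

Lemma cliqueP G A : reflect {in A &, forall u v, u != v -> G u v} (clique G A).
Proof.
apply: (iffP forall_inP) => [cA u v uA vA uv | cA u uA].
  by move/forall_inP: (cA u uA) => /(_ v vA); rewrite uv.
by apply/forall_inP => v vA; apply/implyP; apply: cA.
Qed.

Lemma star_subrel G x : subrel G (star G x).
Proof. by move=> u v Guv; rewrite starE Guv. Qed.

Lemma star_adj_heavy_pair G x u v :
  G x u -> G x v -> heavy_pair G u v -> star G x u v.
Proof. by move=> xu xv h; rewrite starE xu xv h orbT. Qed.

(** * Vertices that are not c-eligible *)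

(** G*[N(x)] has no three independent vertices: they would be the leaves of a claw of [G] centred at
    [x], whose heavy pair is an edge of the star. A disconnected graph with this property is a union
    of two disjoint cliques. *)
Lemma not_eligible_split G x : claw_o_heavy G -> ~ c_eligible G x ->
  ~~ clique G (nbhd G x) ->
  exists C1 C2, two_disjoint_cliques (star G x) (nbhd G x) C1 C2.
Proof.
move=> /claw_o_heavyP clawG nel ncl; set S := star G x; set N := nbhd G x.
pose e := induced S N.
have e_sym : connect_sym e.
  by apply: sym_connect_sym => u v; apply/and3P/and3P => -[uN vN uv];
    split=> //; rewrite adj_sym.
have [/'forall_in_forall_inP con|] :=
    boolP [forall u in N, forall v in N, connect e u v].
  case: nel; split=> //; left; split; last by move=> u v uN vN; apply: con.
  by case/forall_inPn: ncl => u uN _; apply/set0Pn; exists u.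
case/forall_inPn => u uN /forall_inPn[v vN nuv].
have step t1 t2 : t1 \in N -> t2 \in N -> S t1 t2 -> connect e t1 t2.
  by move=> h1 h2 h; apply: connect1; apply/and3P.
have ind p q r : p \in N -> q \in N -> r \in N ->
    ~~ connect e p r -> ~~ connect e q r -> p != q -> S p q.
  rewrite !inE => pN qN rN pr qr pq; apply: contraT => npq.
  have nS s : G x s -> ~~ connect e s r -> s != r /\ ~~ S s r.
    move=> sN sr; split; first by apply: contraNneq sr => ->; apply: connect0.
    by apply: contra sr; apply: step; rewrite inE.
  have [npr nSpr] := nS _ pN pr; have [nqr nSqr] := nS _ qN qr.
  have nGS s t : ~~ S s t -> ~~ G s t by apply/contra/star_subrel.
  have := clawG _ _ _ _ pN qN rN pq npr nqr (nGS _ _ npq) (nGS _ _ nSpr) (nGS _ _ nSqr).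
  by case/or3P => h; [move: npq | move: nSpr | move: nSqr];
    rewrite /S star_adj_heavy_pair.
exists [set t in N | connect e u t], [set t in N | ~~ connect e u t]; split.
- by apply/setP => t; rewrite !inE -andb_orr orbN andbT.
- by apply/pred0P => t; rewrite /= !inE; case: connect; rewrite ?andbF.
- apply/cliqueP => p q /setIdP[pN up] /setIdP[qN uq] pq.
  by apply: (ind _ _ v) => //; apply: contra nuv; apply: connect_trans.
- apply/cliqueP => p q /setIdP[pN up] /setIdP[qN uq] pq.
  by apply: (ind _ _ u) => //; rewrite e_sym.
- move=> p q /setIdP[pN up] /setIdP[qN uq].
  by apply: contra uq => h; apply: (connect_trans up); apply: step.
Qed.

(** Being nonadjacent in the star, [u] and [v] lie in different cliques of the split. A common
    star-neighbour in N(x) would join these cliques, and a [z] as in the second claim would make [x]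
    c-eligible. *)
Lemma not_eligible_sides G x u v : claw_o_heavy G -> ~ c_eligible G x ->
  G x u -> G x v -> u != v -> ~~ star G x u v ->
  (forall t, G x t -> star G x t u -> star G x t v -> False) /\
  (forall z, heavy_pair G x z -> G z u -> G z v -> False).
Proof.
move=> clawG nel xu xv uv nuv.
have ncl : ~~ clique G (nbhd G x).
  by apply: (@not_clique _ _ u v); rewrite ?inE //; apply: contra nuv => /star_subrel.
have [C1 [C2 tdc]] := not_eligible_split clawG nel ncl.
have [U _ K1 K2 X] := tdc.
have cov t : G x t -> (t \in C1) || (t \in C2).
  by move=> xt; rewrite -in_setU U inE.
have X' p q : p \in C2 -> q \in C1 -> ~~ star G x p q.
  by move=> h1 h2; rewrite adj_sym; apply: X.
have sep : (u \in C1) && (v \in C2) || (u \in C2) && (v \in C1).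
  case/orP: (cov u xu) => hu; case/orP: (cov v xv) => hv; rewrite hu hv ?orbT //.
    by move/cliqueP: K1 => /(_ u v hu hv uv) h; rewrite h in nuv.
  by move/cliqueP: K2 => /(_ u v hu hv uv) h; rewrite h in nuv.
split=> [t xt tu tv | z xz zu zv].
  case/orP: sep => /andP[hu hv]; case/orP: (cov t xt) => ht.
  - by have := X _ _ ht hv; rewrite tv.
  - by have := X' _ _ ht hu; rewrite tu.
  - by have := X _ _ ht hu; rewrite tu.
  - by have := X' _ _ ht hv; rewrite tv.
case: nel; split=> //; right; exists C1, C2; split=> //.
by case/orP: sep => /andP[hu hv]; [exists z, u, v | exists z, v, u].
Qed.

(** Otherwise [u] would be a hub of G*[N(x)], which would then be connected. *)
Lemma not_eligible_far G x u : ~ c_eligible G x -> ~~ clique G (nbhd G x) ->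
  G x u -> exists w, [&& G x w, w != u & ~~ star G x w u].
Proof.
move=> nel ncl xu; apply/existsP; apply: contra_notT nel => /existsPn no.
split=> //; left; split; first by apply/set0Pn; exists u; rewrite inE.
have hub w : w \in nbhd G x ->
    connect (induced (star G x) (nbhd G x)) w u /\
    connect (induced (star G x) (nbhd G x)) u w.
  move=> wN; have := no w; move: (wN); rewrite inE => ->.
  have [->|_] := eqVneq w u; first by split; apply: connect0.
  rewrite negbK => h; split; apply: connect1; apply/and3P; split=> //;
  by rewrite ?inE // adj_sym.
by move=> p q /hub[h _] /hub[_]; apply: connect_trans.
Qed.

(* [deg u + deg v] exceeds [#|T| - 2] by the number of common neighbours minus
   the number of vertices outside both closed neighbourhoods. *)
Lemma heavy_pair_count G u v D (f : T -> T) : heavy_pair G u v ->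
  #|nbhd G u :&: nbhd G v| <= #|D|.+1 -> {in D &, injective f} ->
  {in D, forall y, [&& f y != u, f y != v, ~~ G u (f y) & ~~ G v (f y)]} -> False.
Proof.
move=> /and3P[uv nuv le_n] leD injf outf.
have fD : f @: D \subset ~: (u |: (v |: (nbhd G u :|: nbhd G v))).
  apply/subsetP => _ /imsetP[y yD ->]; rewrite !inE !negb_or.
  by case/and4P: (outf y yD) => -> -> -> ->.
have := subset_leq_card fD; rewrite card_in_imset //.
have := cardsC (u |: (v |: (nbhd G u :|: nbhd G v))).
rewrite !cardsU1 !inE (negPf uv) !adj_irr (adj_sym G v u) (negPf nuv) /=.
have := cardsUI (nbhd G u) (nbhd G v); move: le_n leD; rewrite /deg.
by move: #|_ :|: _| #|_ :&: _| #|~: _| #|T| #|nbhd G u| #|nbhd G v| #|D|; lia.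
Qed.

(** Suppose {x, z} is a heavy pair. Around each common neighbour [y] the star joins [x] to [z], and
    some [w y] lies in the other clique of N(y), hence outside both closed neighbourhoods. Distinct
    [y] have distinct [w y], which contradicts [heavy_pair_count]. *)
Lemma closed_no_heavy_pair G : claw_o_heavy G -> (forall x, ~ c_eligible G x) ->
  forall u v, ~~ heavy_pair G u v.
Proof.
move=> clawG nel x z; apply/negP => hxz.
have /and3P[neq_xz nxz _] := hxz.
pose K := nbhd G x :&: nbhd G z.
have inK y : y \in K -> [/\ G x y, G z y, G y x & G y z].
  by rewrite !inE => /andP[xy zy]; split; rewrite // adj_sym.
(* The implication makes the choice total; outside [K] the value [x] is a placeholder. *)
have far y : exists w, (y \in K) ==> [&& G y w, w != x & ~~ star G y w x].
  have [/inK[xy zy yx yz]|_] := boolP (y \in K); last by exists x.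
  apply: not_eligible_far => //.
  by apply: (@not_clique _ _ x z); rewrite ?inE.
pose w y := xchoose (far y).
have wP y : y \in K -> [&& G y (w y), w y != x & ~~ star G y (w y) x].
  exact: (implyP (xchooseP (far y))).
have sides y : y \in K ->
    (forall t, G y t -> star G y t (w y) -> star G y t x -> False) /\
    (forall t, heavy_pair G y t -> G t (w y) -> G t x -> False).
  move=> yK; have /and3P[yw wx nwx] := wP y yK; have [_ _ yx _] := inK y yK.
  exact: not_eligible_sides.
have K_sep y y' : y \in K -> y' \in K -> y != y' -> ~~ G y' (w y).
  move=> yK y'K yy'; apply/negP => y'w.
  have [xy zy yx yz] := inK y yK; have [xy' zy' y'x y'z] := inK y' y'K.
  have [near_sep heavy_sep] := sides y yK.
  (* If adjacent to [y], the vertex [y'] would link the two sides of N(y); if {y, y'} were a heavy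
     pair, [y] would be c-eligible. Otherwise [y] and [y'] lie on different sides of N(x), and [z]
     makes [x] c-eligible. *)
  have [Gyy'|nyy'] := boolP (G y y').
    exact: (near_sep _ Gyy' (star_subrel _ y'w) (star_subrel _ y'x)).
  apply: (heavy_sep _ _ y'w y'x); apply: contraT => nh.
  have nst : ~~ star G x y y' by rewrite starE negb_or nyy' (negPf nh) !andbF.
  by case: (not_eligible_sides clawG (nel x) xy xy' yy' nst) => _ /(_ z hxz zy zy').
apply: (@heavy_pair_count _ _ _ K w hxz) => //.
  move=> y y' yK y'K eqw; apply/eqP; apply: contraT => yy'.
  by have := K_sep _ _ yK y'K yy'; rewrite eqw; case/and3P: (wP y' y'K) => ->.
move=> y yK; have /and3P[yw wx nwx] := wP y yK.
have [xy zy yx yz] := inK y yK; have [near_sep _] := sides y yK.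
have stzx : star G y z x by rewrite star_adj_heavy_pair // heavy_pairC.
rewrite wx /=; apply/and3P; split.
- by apply: contraNneq nwx => ->.
- by apply: contra nwx => xw; apply: star_subrel; rewrite adj_sym.
- by apply/negP => zw; apply: (near_sep z yz _ stzx); apply: star_subrel.
Qed.

Definition diamond_free G := forall p q u v,
  G p q -> G p u -> G p v -> G q u -> G q v -> u != v -> G u v.

(** Without heavy pairs the star adds no edge, so nonadjacent [u] and [v] lie on different sides of
    N(p), and [q] would join the sides. *)
Lemma closed_diamond_free G : claw_o_heavy G -> (forall x, ~ c_eligible G x) ->
  diamond_free G.
Proof.
move=> clawG nel p q u v pq pu pv qu qv uv; apply: contraT => nuv.
have nst : ~~ star G p u v.
  by rewrite starE negb_or nuv (negPf (closed_no_heavy_pair clawG nel u v)) !andbF.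
have [/(_ q pq) h _] := not_eligible_sides clawG (nel p) pu pv uv nst.
by case: h; apply: star_subrel.
Qed.

(** * The invariant along the closure *)

(** Completion at [t] leaves N(x) unchanged unless [x] is adjacent to [t]. In that case N[x] was
    already inside N[t], so every new neighbour of [x] is in N[t] too, and completion turns N[t]
    into a clique. *)
Lemma c_closure_simplicial G H x :
  c_closure G H -> clique G (nbhd G x) -> clique H (nbhd H x).
Proof.
elim=> [//|{}G t {}H _ _ IH /cliqueP clx]; apply/IH/cliqueP => u v.
rewrite !inE => xu xv uv.
have [xt|nxt] := boolP (G x t); last first.
  have old s : local_completion G t x s -> G x s.
    by move=> xs; apply: contraT => /(completion_new xs)[]; rewrite adj_sym (negPf nxt).
  by apply/completion_subrel/clx; rewrite ?inE ?old.
have near s : local_completion G t x s -> (s == t) || G t s.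
  move=> xs; have [xs'|/(completion_new xs)[_ ->]] := boolP (G x s); last exact: orbT.
  by have [//|st] := eqVneq s t; apply: clx; rewrite ?inE // eq_sym.
case/orP: (near _ xv) => [/eqP vt|tv]; last exact: completion_adj_closed (near _ xu) tv uv.
rewrite adj_sym; apply: completion_adj_closed (near _ xv) _ _; last by rewrite eq_sym.
by case/orP: (near _ xu) => // /eqP ut; move: uv; rewrite ut vt eqxx.
Qed.

Lemma completion_simplicial G x :
  clique (local_completion G x) (nbhd (local_completion G x) x).
Proof.
have old s : local_completion G x x s -> G x s.
  by move=> xs; apply: contraT => /(completion_new xs)[]; rewrite adj_irr.
by apply/cliqueP => u v; rewrite !inE => /old xu /old xv; apply: completion_adj.
Qed.

(* By diamond-freeness, a completion never gives a vertex [y] its first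
   neighbour outside a maximal clique of [H] that contains [y]. *)
Lemma c_closure_outer_nbr G H x y w : c_closure G H -> diamond_free H ->
  H x y -> H y w -> w != x -> ~~ H x w ->
  exists w', [/\ G y w', w' != x & ~~ H x w'].
Proof.
elim=> [{}G _ _ xy yw wx nxw|{}G t {}H elt clH IH dH xy yw wx nxw]; first by exists w.
have sH : subrel G H := c_closure_subrel (CClosureStep elt clH).
have [w' [yw' w'x nxw']] := IH dH xy yw wx nxw.
have [|/(completion_new yw')[ty tw']] := boolP (G y w'); first by exists w'.
(* The centre [t] takes over as outer neighbour: if it were adjacent to [x], then [x] and [w'] would
   both be joined to the edge [y t], forcing [H x w']. *)
exists t; rewrite adj_sym ty; split=> //.
  by apply: contraNneq nxw' => <-; apply: sH.
apply: contra nxw' => xt; apply: (dH y t).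
- by rewrite adj_sym sH.
- by rewrite adj_sym.
- exact: c_closure_subrel yw'.
- by rewrite adj_sym.
- exact: sH.
- by rewrite eq_sym.
Qed.

(* [G] stands for an intermediate graph and [H] for its closure. When [G] is
   claw-o-heavy, [a] and [b] need not be assumed adjacent. *)
Definition pendant_heavy G H := forall a b c d,
  a != b -> G c a -> G c b -> G c d -> a != d -> b != d -> ~~ H a d -> ~~ H b d ->
  heavy H a || heavy H b.

(** Here N[x] is contained in N[u]. Thus heaviness of a simplicial vertex passes to its whole
    clique, and lightness of any member passes back to it. *)
Lemma deg_simplicial H x u : clique H (nbhd H x) -> (u == x) || H x u ->
  deg H x <= deg H u.
Proof.
move=> /cliqueP clx ux; apply: deg_le_of_cnbhd => [w xw|].
  case/orP: ux => [/eqP->|xu]; first by rewrite xw orbT.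
  by have [//|wu] := eqVneq w u; rewrite clx ?inE // eq_sym.
by case/orP: ux => [/eqP->|]; rewrite ?eqxx // [H u x]adj_sym => ->; rewrite orbT.
Qed.

(** * One completion step, seen inside the clique K = N_H[x] *)

Section Step.
Variables (G H : sgraph T) (x : T).
Hypothesis elx : c_eligible G x.
Hypothesis clH : c_closure (local_completion G x) H.
Hypotheses (dH : diamond_free H) (nhpH : forall u v, ~~ heavy_pair H u v).
Hypothesis invG : pendant_heavy G H.

Let clGH : c_closure G H := CClosureStep elx clH.
Let sGH : subrel G H := c_closure_subrel clGH.
Let simpl_x : clique H (nbhd H x) :=
  c_closure_simplicial clH (completion_simplicial G x).
Let in_K u := (u == x) || H x u.

Let K_adj u v : in_K u -> in_K v -> u != v -> H u v.
Proof.
rewrite /in_K => /orP[/eqP->|xu] /orP[/eqP->|xv] uv //; first by rewrite eqxx in uv.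
  by rewrite adj_sym.
by move/cliqueP: simpl_x; apply; rewrite ?inE.
Qed.

(** Otherwise [x] and [w] would form a diamond on the edge [u v]. So a vertex outside K has at most
    one [H]-neighbour in K. *)
Let K_max u v w : in_K u -> in_K v -> u != v -> H u w -> H v w -> in_K w.
Proof.
move=> Ku Kv uv uw vw; rewrite /in_K; have [//|wx /=] := eqVneq w x.
have [<-//|ux] := eqVneq u x; have [<-//|vx] := eqVneq v x.
by apply: (dH (K_adj Ku Kv uv)); rewrite 1?eq_sym //; apply: K_adj; rewrite // /in_K eqxx.
Qed.

Let heavy_pair_adj u v : heavy_pair G u v -> H u v.
Proof.
by move=> h; apply: contraT => n; rewrite -(negbTE (nhpH u v)) (heavy_pair_mono sGH).
Qed.

Let outer y : in_K y -> ~~ clique H (nbhd H y) ->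
  exists w, [/\ G y w, w != x & ~~ H x w].
Proof.
move=> Ky ncl.
have [yx|yx] := eqVneq y x; first by rewrite yx simpl_x in ncl.
have xy : H x y by move: Ky; rewrite /in_K (negPf yx).
have [allK|] := boolP [forall w in nbhd H y, in_K w].
  case/negP: ncl; apply/cliqueP => u v uN vN; move/forall_inP: allK => h.
  by apply: K_adj; apply: h.
case/forall_inPn => w; rewrite inE /in_K negb_or => yw /andP[wx nxw].
exact: c_closure_outer_nbr clGH dH xy yw wx nxw.
Qed.

Hypothesis light_x : ~~ heavy H x.

(** By [deg_simplicial] at [s], the degree of [s] is at most that of the light vertex [x]. *)
Let simpl_light s : in_K s -> clique H (nbhd H s) -> ~~ heavy H s.
Proof.
move=> Ks cls; apply: contra light_x; rewrite /heavy => h; apply: (leq_trans h).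
rewrite leq_mul2l /= deg_simplicial //.
by move: Ks; rewrite /in_K adj_sym eq_sym.
Qed.

(** If [y] is not simplicial, it has a [G]-neighbour [w] outside K. By [K_max], [s] and [t] are not
    [H]-adjacent to [w], so the invariant at [y] makes one of them heavy. *)
Let two_light_nbrs y s t : in_K y -> in_K s -> in_K t -> s != t ->
  G y s -> G y t -> ~~ heavy H s -> ~~ heavy H t -> clique H (nbhd H y).
Proof.
move=> Ky Ks Kt st ys yt ls lt; apply: contraT => ncl.
have [w [yw wx nxw]] := outer Ky ncl.
have nKw : ~~ in_K w by rewrite /in_K negb_or wx.
have nsw u : in_K u -> G y u -> u != w /\ ~~ H u w.
  move=> Ku yu; split; first by apply: contraNneq nKw => <-.
  by apply: contra nKw; apply: (K_max Ky Ku (adj_neq yu)); apply: sGH.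
have [sw nHsw] := nsw s Ks ys; have [tw nHtw] := nsw t Kt yt.
by have := invG st ys yt yw sw tw nHsw nHtw; rewrite (negPf ls) (negPf lt).
Qed.

(* The common neighbours of [u] and [v] that are not simplicial in [H] have
   pairwise distinct outer neighbours, so counting leaves two simplicial ones. *)
Let no_heavy_pair_in_K u v : in_K u -> in_K v -> ~~ heavy_pair G u v.
Proof.
move=> Ku Kv; apply/negP => huv; have /and3P[uv _ _] := huv.
pose D := nbhd G u :&: nbhd G v.
pose D' := [set y in D | ~~ clique H (nbhd H y)].
have DK y : y \in D -> [/\ in_K y, G u y & G v y].
  rewrite !inE => /andP[uy vy]; split=> //.
  by apply: (K_max Ku Kv uv); apply: sGH.
have out y : exists w, (y \in D') ==> [&& G y w, w != x & ~~ H x w].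
  have [|_] := boolP (y \in D'); last by exists x.
  rewrite in_set => /andP[/DK[Ky _ _] /(outer Ky)[w [? ? ?]]].
  by exists w; apply/and3P.
pose f y := xchoose (out y).
have fP y : y \in D' -> [/\ y \in D, G y (f y) & ~~ in_K (f y)].
  move=> yD'; have /and3P[h1 h2 h3] := implyP (xchooseP (out y)) yD'.
  split=> //; last by rewrite /in_K negb_or h2.
  by move: yD'; rewrite in_set => /andP[].
(* The slack of one in [heavy_pair_count] is what gives two simplicial common neighbours rather than
   one. *)
have lt_D : #|D'|.+1 < #|D|.
  rewrite ltnNge; apply/negP => leD.
  apply: (heavy_pair_count (f := f) huv leD) => [y y' yD y'D eqf | y yD].
    have [Dy yf nKf] := fP y yD; have [Dy' y'f _] := fP y' y'D.
    have [Ky _ _] := DK y Dy; have [Ky' _ _] := DK y' Dy'.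
    apply/eqP; apply: contraT => yy'; case/negP: nKf.
    by apply: (K_max Ky Ky' yy'); apply: sGH; rewrite // eqf.
  have [Dy yf nKf] := fP y yD; have [Ky uy vy] := DK y Dy.
  have nf t : in_K t -> G t y -> (f y != t) && ~~ G t (f y).
    move=> Kt ty; apply/andP; split; first by apply: contraNneq nKf => ->.
    by apply: contra nKf => tf; apply: (K_max Ky Kt); rewrite 1?eq_sym ?(adj_neq ty) //; apply: sGH.
  by case/andP: (nf u Ku uy) => -> ->; case/andP: (nf v Kv vy) => -> ->.
have : 1 < #|D :\: D'|.
  have sD : D' \subset D by apply/subsetP => y; rewrite in_set => /andP[].
  by rewrite cardsD (setIidPr sD); lia.
case/card_gt1P => s [t [sD tD st]].
have lightD y : y \in D :\: D' -> [/\ in_K y, G u y, G v y & ~~ heavy H y].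
  rewrite in_setD in_set negb_and negbK => /andP[h Dy].
  have [Ky uy vy] := DK y Dy; rewrite Dy /= in h.
  by split=> //; apply: simpl_light.
have [Ks us vs ls] := lightD s sD; have [Kt ut vt lt] := lightD t tD.
(* The light vertices [s] and [t] make [u] and [v] simplicial, hence light in [H] and so in [G]; two
   light vertices form no heavy pair. *)
have lu := simpl_light Ku (two_light_nbrs Ku Ks Kt st us ut ls lt).
have lv := simpl_light Kv (two_light_nbrs Kv Ks Kt st vs vt ls lt).
by case/negP: (@light_heavy_pair G u v (contra (heavy_mono sGH) lu)
  (contra (heavy_mono sGH) lv)).
Qed.

Let N_K y : y \in nbhd G x -> in_K y.
Proof. by rewrite inE /in_K => /sGH->; rewrite orbT. Qed.

(** The split form of eligibility would need a heavy pair {x, z} inside K, and in the connected form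
    every extra star edge is a heavy pair inside K. Both are excluded. *)
Let nbhd_connected :
  {in nbhd G x &, forall u v, connect (induced G (nbhd G x)) u v}.
Proof.
have Kx : in_K x by rewrite /in_K eqxx.
case: elx => _ [[_ con] u v uN vN|[C1 [C2 [_ [z [y1 [y2 [hxz _ _ _ _]]]]]]]]; last first.
  have Kz : in_K z by rewrite /in_K heavy_pair_adj ?orbT.
  by have := no_heavy_pair_in_K Kx Kz; rewrite hxz.
apply: connect_sub (con u v uN vN) => s t /and3P[sN tN st].
apply: connect1; apply/and3P; split=> //.
by move: st; rewrite starE => /orP[//|] /and3P[_ _]; rewrite (negPf (no_heavy_pair_in_K _ _)) ?N_K.
Qed.

Lemma light_nbrs_simplicial a c : ~~ heavy H a -> G x a -> G x c -> a != c ->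
  clique H (nbhd H c).
Proof.
move=> la xa xc ac.
have Kx : in_K x by rewrite /in_K eqxx.
have light_step s t : ~~ heavy H s -> induced G (nbhd G x) s t ->
    clique H (nbhd H t).
  move=> ls /and3P[sN tN st]; move: (sN) (tN); rewrite !inE => xs xt.
  by apply: (two_light_nbrs (N_K tN) Kx (N_K sN) (adj_neq xs)) => //; rewrite adj_sym.
(* The start [a] is only known to be light. Each later vertex of the path has the light neighbours
   [x] and its predecessor, so it is simplicial, hence light, and the argument continues. *)
pose Z := [pred t | (t == a) || (t \in nbhd G x) && clique H (nbhd H t)].
have ZP s t : s \in Z -> induced G (nbhd G x) s t -> t \in Z.
  move=> sZ st; have /and3P[_ tN _] := st.
  apply/orP; right; rewrite tN /=; apply: light_step st.
  by case/orP: sZ => [/eqP->//|/andP[sN]]; apply: simpl_light; apply: N_K.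
have con : connect (induced G (nbhd G x)) a c by apply: nbhd_connected; rewrite inE.
have : c \in Z.
  case/connectP: con => l; have : a \in Z by rewrite inE eqxx.
  elim: l (a) => [s sZ _ ->//|t l IH s sZ /= /andP[st pl] el].
  by apply: (IH t) => //; apply: ZP st.
by rewrite inE eq_sym (negPf ac) /= => /andP[].
Qed.

End Step.

Lemma pendant_heavy_step G H x : c_eligible G x ->
  c_closure (local_completion G x) H -> diamond_free H ->
  (forall u v, ~~ heavy_pair H u v) -> pendant_heavy G H ->
  pendant_heavy (local_completion G x) H.
Proof.
move=> elx clH dH nhpH invG a b c d ab ca cb cd ad bd nad nbd.
have clGH := CClosureStep elx clH.
have sGH := c_closure_subrel clGH; have s1H := c_closure_subrel clH.
have simpl_x := c_closure_simplicial clH (completion_simplicial G x).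
apply: contraT; rewrite negb_or => /andP[la lb].
have xd t : G x d -> t != d -> ~~ H t d -> ~~ ((t == x) || G x t).
  by move=> xd td; apply: contra => tx; apply/s1H/completion_adj_closed.
have [Gcd|ncd] := boolP (G c d); last first.
  (* If [c d] is new, [x] replaces [d] as the pendant vertex: the edges [c a] and [c b] are old, and
     an [H]-edge from [a] or [b] to [x] would complete a diamond on [c x]. *)
  have [xc xd'] := completion_new cd ncd.
  have old t : local_completion G x c t -> t != d -> ~~ H t d ->
      [/\ G c t, t != x & ~~ H t x].
    move=> ct td ntd; have := xd t xd' td ntd; rewrite negb_or => /andP[tx nxt].
    split=> //; first by apply: contraT => /(completion_new ct)[]; rewrite (negPf nxt).
    have cx : H c x by rewrite adj_sym sGH.
    rewrite adj_sym; apply: contra ntd => tx'.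
    exact: dH cx (s1H _ _ ct) (s1H _ _ cd) tx' (sGH _ _ xd') td.
  have [Gca ax nax] := old a ca ad nad; have [Gcb bx nbx] := old b cb bd nbd.
  have cx : G c x by rewrite adj_sym.
  by have := invG _ _ _ _ ab Gca Gcb cx ax bx nax nbx; rewrite (negPf la) (negPf lb).
have old a' : local_completion G x c a' -> a' != d -> ~~ H a' d ->
    ~~ heavy H a' -> G c a'.
  move=> ca' a'd na'd la'; apply: contraT => nca'.
  (* If [c a'] is new, [x] is light along with [a'], so [c] is simplicial in [H]; but its neighbours
     [x] and [d] are not [H]-adjacent. *)
  have [xc xa'] := completion_new ca' nca'.
  have lx : ~~ heavy H x.
    apply: contra la'; rewrite /heavy => h; apply: (leq_trans h).
    by rewrite leq_mul2l deg_simplicial // sGH ?orbT.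
  have nxd : ~~ H x d.
    have cx : H c x by rewrite adj_sym sGH.
    apply: contra na'd => xd'.
    exact: dH cx (s1H _ _ ca') (s1H _ _ cd) (sGH _ _ xa') xd' a'd.
  have neq_xd : x != d by apply: contraNneq na'd => <-; rewrite adj_sym sGH.
  have ac' : a' != c by rewrite eq_sym (adj_neq ca').
  have := light_nbrs_simplicial elx clH dH nhpH invG lx la' xa' xc ac'.
  move/cliqueP => /(_ x d); rewrite !inE (negPf nxd) => h.
  by apply: h; [rewrite adj_sym sGH | apply: sGH |].
have Gca := old a ca ad nad la; have Gcb := old b cb bd nbd lb.
by have := invG _ _ _ _ ab Gca Gcb Gcd ad bd nad nbd; rewrite (negPf la) (negPf lb).
Qed.

Lemma pendant_heavy_closure G H : c_closure G H ->
  diamond_free H -> (forall u v, ~~ heavy_pair H u v) ->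
  pendant_heavy G H -> pendant_heavy H H.
Proof.
elim=> [//|{}G x {}H elx clH IH dH nhpH invG].
by apply: IH => //; apply: pendant_heavy_step.
Qed.

End Graphs.

(** * Z_1-c-heaviness as a condition on a triangle with a pendant edge *)

(** Deleting the maximal clique {c, d} leaves the component {a, b}. *)
Lemma Z1_c_heavy_triangle (T : finType) (G : sgraph T) (a b c d : T) :
  c_heavy Z1 G -> G a b -> G a c -> G b c -> G c d ->
  a != d -> b != d -> ~~ G a d -> ~~ G b d -> heavy G a || heavy G b.
Proof.
move=> Z1G ab ac bc cd ad bd nad nbd.
pose l := [:: a; b; c; d]; pose f (i : 'I_4) := nth a l i.
have ul : uniq l.
  by rewrite /= !inE !negb_or (adj_neq ab) (adj_neq ac) (adj_neq bc) (adj_neq cd) ad bd.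
have AE : [set f i | i : 'I_4] = [set a; b; c; d].
  apply/setP => t; apply/imsetP/idP => [[[i lt_i] _ ->]|].
    by case: i lt_i => [|[|[|[|//]]]] ?; rewrite /f /= !inE eqxx ?orbT.
  by rewrite !inE -!orbA => /or4P[]/eqP->;
    [exists (@Ordinal 4 0 isT) | exists (@Ordinal 4 1 isT)
    | exists (@Ordinal 4 2 isT) | exists (@Ordinal 4 3 isT)].
have copy : induced_copy Z1 G [set a; b; c; d].
  exists f; split=> // [i j /eqP|i j].
    by rewrite nth_uniq ?ltn_ord // => /eqP/val_inj.
  have sy := adj_sym G.
  case: i => [[|[|[|[|//]]]] ?]; case: j => [[|[|[|[|//]]]] ?];
    rewrite /f /= /Z1_rel /= ?adj_irr // ?ab ?ac ?bc ?cd ?(negPf nad) ?(negPf nbd) //;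
    by rewrite sy ?ab ?ac ?bc ?cd ?(negPf nad) ?(negPf nbd).
have maxC : maximal_clique G [set a; b; c; d] [set c; d].
  apply/maxsetP; split=> [|B /andP[/subsetP sB /cliqueP clB] /subsetP sCB].
    apply/andP; split; first by apply/subsetP => t; rewrite !inE => /orP[]->; rewrite ?orbT.
    apply/cliqueP => u v; rewrite !inE => /orP[]/eqP-> /orP[]/eqP->; rewrite ?eqxx //.
    by rewrite adj_sym.
  have dB : d \in B by apply: sCB; rewrite !inE eqxx orbT.
  apply/eqP; rewrite eqEsubset; apply/andP; split; last exact/subsetP.
  apply/subsetP => t tB; have := sB t tB; rewrite !inE -!orbA.
  case/or4P=> [/eqP ta|/eqP tb|->//|->]; last by rewrite orbT.
    by case/negP: nad; rewrite -ta; apply: clB; rewrite // ta.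
  by case/negP: nbd; rewrite -tb; apply: clB; rewrite // tb.
have AC : [set a; b; c; d] :\: [set c; d] = [set a; b].
  apply/setP => t; rewrite !inE.
  have [->|] := eqVneq t c; first by rewrite ![c == _]eq_sym (negPf (adj_neq ac)) (negPf (adj_neq bc)).
  have [->|] := eqVneq t d; last by rewrite !orbF.
  by rewrite ![d == _]eq_sym (negPf ad) (negPf bd).
have comp : component G ([set a; b; c; d] :\: [set c; d]) [set a; b].
  rewrite AC; exists a; first by rewrite !inE eqxx.
  apply/setP => t; rewrite [RHS]in_set; case: (boolP (t \in [set a; b])) => //=.
  rewrite !inE => /orP[]/eqP->; first by rewrite connect0.
  by apply/esym/connect1/and3P; rewrite !inE !eqxx ab orbT.
have [|v] := Z1G _ copy _ maxC _ comp; first by rewrite cards2 (adj_neq ab).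
by rewrite !inE => /orP[]/eqP-> ->; rewrite ?orbT.
Qed.

(** A maximal clique of Z_1 is either the triangle, which leaves a single vertex, or the pendant
    edge, which leaves exactly {a, b}. Membership of [d] tells them apart. *)
Lemma triangle_Z1_c_heavy (T : finType) (G : sgraph T) :
  (forall a b c d, G a b -> G a c -> G b c -> G c d -> a != d -> b != d ->
     ~~ G a d -> ~~ G b d -> heavy G a || heavy G b) ->
  c_heavy Z1 G.
Proof.
move=> triG A [f [injf fG AE]] C /maxsetP[/andP[/subsetP sC /cliqueP clC] maxC].
move=> D [x xA DE] gt1D.
pose a := f (@Ordinal 4 0 isT); pose b := f (@Ordinal 4 1 isT).
pose c := f (@Ordinal 4 2 isT); pose d := f (@Ordinal 4 3 isT).
have fE i j : (f i == f j) = (i == j) by rewrite (inj_eq injf).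
have ab : G a b by rewrite fG.
have ac : G a c by rewrite fG.
have bc : G b c by rewrite fG.
have cd : G c d by rewrite fG.
have ad : a != d by rewrite fE.
have bd : b != d by rewrite fE.
have nad : ~~ G a d by rewrite fG.
have nbd : ~~ G b d by rewrite fG.
have inA t : (t \in A) = [|| t == a, t == b, t == c | t == d].
  rewrite AE; apply/imsetP/idP => [[[i lt_i] _ ->]|].
    by case: i lt_i => [|[|[|[|//]]]] ?; rewrite !fE ?orbT.
  by case/or4P=> /eqP->; eexists.
have clique_max (B : {set T}) : B \subset A -> clique G B -> C \subset B -> B = C.
  by move=> sBA clB; apply: maxC; rewrite /= sBA.
have [dC|ndC] := boolP (d \in C); last first.
  have sCB : C \subset [set a; b; c].
    apply/subsetP => t tC; have := sC t tC; rewrite inA !inE -!orbA.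
    by case/or4P=> [->|->|->|/eqP td]; rewrite ?orbT // -td tC in ndC *.
  have CE : [set a; b; c] = C.
    apply: clique_max => //.
      by apply/subsetP => t; rewrite inA !inE -!orbA => /or3P[]->; rewrite ?orbT.
    by apply/cliqueP => u v; rewrite !inE -!orbA => /or3P[]/eqP-> /or3P[]/eqP->;
      rewrite ?eqxx // => _; rewrite adj_sym.
  have : D \subset [set d].
    apply/subsetP => t; rewrite DE -CE !inE inA -!orbA !negb_or.
    by case/andP=> /andP[/and3P[/negPf-> /negPf-> /negPf->]].
  by move/subset_leq_card; rewrite cards1; lia.
have naC : a \notin C by apply: contra nad => aC; apply: clC.
have nbC : b \notin C by apply: contra nbd => bC; apply: clC.
have cC : c \in C.
  rewrite -(clique_max (c |: C)) ?setU11 ?subsetUr //.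
    by rewrite subUset sub1set inA eqxx ?orbT /=; apply/subsetP.
  have cC t : t \in C -> c != t -> G c t.
    move=> tC ct; have := sC t tC; rewrite inA.
    case/or4P=> /eqP te; rewrite te ?(negPf naC) ?(negPf nbC) ?eqxx // in tC ct *.
  apply/cliqueP => u v /setU1P[->|uC] /setU1P[->|vC]; rewrite ?eqxx //.
  - exact: cC.
  - by rewrite eq_sym adj_sym; apply: cC.
  - exact: clC.
have AC t : (t \in A :\: C) = (t == a) || (t == b).
  rewrite in_setD inA; apply/andP/orP => [[tC]|].
    by case/or4P=> /eqP te; rewrite te ?cC ?dC ?eqxx // in tC *; [left | right].
  by case=> /eqP->; rewrite ?naC ?nbC eqxx ?orbT.
have inD t : t \in A :\: C -> t \in D.
  move=> tAC; rewrite DE in_set tAC; have := tAC; have := xA; rewrite !AC.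
  have eab : connect (induced G (A :\: C)) a b.
    by apply: connect1; apply/and3P; rewrite !AC !eqxx orbT.
  have eba : connect (induced G (A :\: C)) b a.
    by apply: connect1; apply/and3P; rewrite !AC !eqxx orbT adj_sym.
  by move=> /orP[]/eqP-> /orP[]/eqP->; rewrite ?connect0.
case/orP: (triG a b c d ab ac bc cd ad bd nad nbd) => h.
  by exists a => //; apply: inD; rewrite AC eqxx.
by exists b => //; apply: inD; rewrite AC eqxx orbT.
Qed.

Theorem theorem13 (T : finType) (G H : sgraph T)
    (claw_G : claw_o_heavy G) (Z1_G : c_heavy Z1 G) (cl_G : c_closure G H) :
  c_heavy Z1 H.
Proof.
have claw_H := c_closure_claw_o_heavy cl_G claw_G.
have closed_H := c_closure_closed cl_G.
have nhpH := closed_no_heavy_pair claw_H closed_H.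
have dH := closed_diamond_free claw_H closed_H.
have sGH := c_closure_subrel cl_G.
have inv_G : pendant_heavy G H.
  move=> a b c d ab ca cb cd ad bd nad nbd.
  have nG u v : ~~ H u v -> ~~ G u v by apply/contra/sGH.
  have ac : G a c by rewrite adj_sym.
  have bc : G b c by rewrite adj_sym.
  have [Gab|nab] := boolP (G a b).
    have := Z1_c_heavy_triangle Z1_G Gab ac bc cd ad bd (nG _ _ nad) (nG _ _ nbd).
    by case/orP => /(heavy_mono sGH) ->; rewrite ?orbT.
  (* With [a], [b] nonadjacent, [c] is the centre of a claw. A heavy pair containing [d] would
     remain one in [H], so {a, b} is the heavy pair and one of its vertices is heavy. *)
  have nhp u v : ~~ H u v -> ~~ heavy_pair G u v.
    by move=> nuv; apply: contra (nhpH u v); apply: heavy_pair_mono.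
  have := claw_o_heavyP G => -[/(_ claw_G)/(_ c a b d ca cb cd ab ad bd nab) h _].
  have := h (nG _ _ nad) (nG _ _ nbd).
  rewrite (negPf (nhp _ _ nad)) (negPf (nhp _ _ nbd)) !orbF; apply: contraTT.
  rewrite negb_or => /andP[la lb].
  by apply: light_heavy_pair; [apply: contra la | apply: contra lb]; apply: heavy_mono.
have inv_H := pendant_heavy_closure cl_G dH nhpH inv_G.
apply: triangle_Z1_c_heavy => a b c d ab ac bc cd.
by apply: inv_H cd; rewrite ?(adj_neq ab) // adj_sym.
Qed.
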